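(* For all integers $n\ge 1$ and $k\ge 0$, $$\Delta\, \mathcal{Z}_{n,k}(q,v) = (-1)^k\,\widehat{\mathcal{Z}}_{n,k}(q,-v),$$ where $\Delta$ acts on the coefficients in $\mathcal{U}_{n,k}$ (extended $\mathbb{C}[q,v]$-linearly), with all objects as defined in the context.
   Context: Let $\Upsilon_{n,k}$ be the set of undirected graphs with vertices $1,\dots,n$ and $k$ numbered edges, i.e. sequences $G=(\{a_1,b_1\},\dots,\{a_k,b_k\})$ with $a_i,b_i\in\{1,\dots,n\}$ (loops $\{a,a\}$ and repeated edges allowed). Let $\mathcal{U}_{n,k}$ be the complex vector space with basis $\Upsilon_{n,k}$. For a graph $G$ with $k$ edges, its Potts polynomial is $Z_G(q,v)=(v+1)^k C_G(q,1/(v+1))$, where $C_G(q,y)=\sum_{f:\{1,\dots,n\}\to\{1,\dots,q\}} y^{\#\{\text{edges }\{a,b\}\text{ of }G:\ f(a)\neq f(b)\}}$; equivalently $Z_G(q,v)=\sum_{f}(1+v)^{\#\{\text{edges }\{a,b\}:\ f(a)=f(b)\}}$, a polynomial in $q,v$. For $G\in\Upsilon_{n,k}$, $\widehat G$ denotes $G$ with all loops deleted (remaining edges renumbered consecutively preserving order). Define $$\mathcal{Z}_{n,k}(q,v)=\sum_{G\in\Upsilon_{n,k}} Z_{\widehat G}(q,v)\,G,\qquad \widehat{\mathcal{Z}}_{n,k}(q,v)=\sum_{G\in\Upsilon_{n,k},\ G\text{ has no loops}} Z_G(q,v)\,G.$$ Laplace operator: for $i\in\{1,\dots,k\}$ let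 $B_i:\mathcal{U}_{n,k}\to\mathcal{U}_{n,k}$ be linear, defined on $G\in\Upsilon_{n,k}$ with $i$-th edge $\{a,b\}$ by $B_i(G)=G$ if $a\neq b$, and $B_i(G)=-\sum_{m\neq a} G_{i\to\{a,m\}}$ if $a=b$, where $G_{i\to\{a,m\}}$ is $G$ with its $i$-th edge replaced by $\{a,m\}$ (keeping number $i$) and the sum is over $m\in\{1,\dots,n\}\setminus\{a\}$. Then $\Delta=B_1\cdots B_k$. (Equivalently, $\Delta(G)$ is obtained by orienting the edges of $G$ arbitrarily, applying the directed Laplace operator, and forgetting orientations.) *)

(* Defs.v *)
From HB Require Import structures.
From mathcomp Require Import all_boot all_order all_algebra.
From mathcomp Require Import complex.
From mathcomp Require Import boolp reals.

Set Implicit Arguments.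
Unset Strict Implicit.
Unset Printing Implicit Defensive.

Import Order.TTheory GRing.Theory Num.Theory.

Local Open Scope ring_scope.
Local Open Scope complex_scope.

(* Edges are unordered pairs [set a; b], so that a loop is a singleton. *)
Definition is_edge n (e : {set 'I_n}) : bool :=
  [exists a, exists b, e == [set a; b]].

Definition edge n := {e : {set 'I_n} | is_edge e}.

Lemma is_edge_set2 n (a b : 'I_n) : is_edge [set a; b].
Proof. by apply/existsP; exists a; apply/existsP; exists b. Qed.

Definition mk_edge n (a b : 'I_n) : edge n := 
  exist (fun e : {set 'I_n} => is_edge e) _ (is_edge_set2 a b).

Definition is_loop n (e : edge n) : bool := [exists a, e == mk_edge a a].

Definition graph n k := k.-tuple (edge n).

Definition loopless n k (G : graph n k) : bool :=
  all (fun e => ~~ is_loop e) G.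

Definition del_loops n k (G : graph n k) :
    graph n (size [seq e <- G | ~~ is_loop e]) :=
  in_tuple [seq e <- G | ~~ is_loop e].

Definition replace_edge n k (G : graph n k) (i : 'I_k) (e : edge n) :
    graph n k :=
  [tuple if j == i then e else tnth G j | j < k].

Definition bichromatic n q (f : {ffun 'I_n -> 'I_q}) (e : edge n) : bool :=
  [exists a in val e, exists b in val e, f a != f b].

Definition coloring_sum (F : comNzRingType) n k (G : graph n k) (q : nat)
    (y : F) : F :=
  \sum_(f : {ffun 'I_n -> 'I_q}) y ^+ count (bichromatic f) G.

(* Z_G is the polynomial with Z_G(q,v) = (v+1)^k C_G(q,1/(v+1)) for all natural
   numbers q and all v <> -1; existence and uniqueness (over a field of
   characteristic zero) are potts_exists and potts_unique below.
   In {poly {poly F}} the outer variable is q and the inner variable is v: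
   the value of Z at (q, v) is Z.[q%:P].[v]. *)
Definition is_potts (F : fieldType) n k (G : graph n k)
    (Z : {poly {poly F}}) : Prop :=
  forall (q : nat) (v : F), v + 1 != 0 ->
    Z.[(q%:R)%:P].[v] = (v + 1) ^+ k * coloring_sum G q (v + 1)^-1.

Lemma coloring_sumE (F : fieldType) n k (G : graph n k) (q : nat) (v : F) :
  v + 1 != 0 ->
  (v + 1) ^+ k * coloring_sum G q (v + 1)^-1 =
  \sum_(f : {ffun 'I_n -> 'I_q})
     (1 + v) ^+ count (fun e => ~~ bichromatic f e) G.
Proof.
move=> v0; rewrite /coloring_sum big_distrr /=; apply: eq_bigr => f _.
have Ek : (count (bichromatic f) G + count (predC (bichromatic f)) G)%N = k.
  by rewrite count_predC size_tuple.
rewrite -[in X in X * _]Ek exprD exprVn mulrAC mulfV ?expf_neq0 // mul1r.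
by rewrite addrC.
Qed.

Lemma card_const_colorings n (e : rel 'I_n) :
  exists c : nat, forall q : nat,
  #|[set f : {ffun 'I_n -> 'I_q} | [forall a, forall b, e a b ==> (f a == f b)]]|
    = (q ^ c)%N.
Proof.
pose e' := [rel a b | e a b || e b a].
have se : connect_sym e'.
  by apply: sym_connect_sym => a b /=; rewrite orbC.
exists #|{: {x | fingraph.roots e' x}}| => q.
pose rt (x : 'I_n) : {x | fingraph.roots e' x} := exist _ (fingraph.root e' x) (fingraph.roots_root se x).
pose h (g : {ffun {x | fingraph.roots e' x} -> 'I_q}) : {ffun 'I_n -> 'I_q} :=
  [ffun x => g (rt x)].
have hi : injective h.
  move=> g1 g2 /ffunP H; apply/ffunP => x.
  have := H (val x); rewrite !ffunE.
  by suff -> : rt (val x) = x by []; apply/val_inj/eqP; exact: (valP x).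
rewrite -[in RHS](card_ord q) -card_ffun -(card_imset _ hi).
congr #|pred_of_set _|; apply/setP => f; rewrite !inE.
apply/forallP/imsetP => [H | [g _ ->] a].
  have fc a b : connect e' a b -> f a = f b.
    case/connectP => p; elim: p a => [|c p IH] a /=; first by move=> _ ->.
    case/andP => eac pc bl; rewrite -(IH c pc bl).
    case/orP: eac => h1.
      by apply/eqP; move/forallP: (H a) => /(_ c); rewrite h1.
    by apply/esym/eqP; move/forallP: (H c) => /(_ a); rewrite h1.
  exists [ffun x => f (val x)] => //.
  by apply/ffunP => x; rewrite !ffunE /=; apply: fc; exact: connect_root.
apply/forallP => b; apply/implyP => eab; rewrite !ffunE.
suff -> : rt a = rt b by [].
apply/val_inj => /=; apply/(fingraph.rootP se); apply: connect1.
by rewrite /= eab.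
Qed.

Lemma potts_exists (F : fieldType) n k (G : graph n k) :
  exists Z : {poly {poly F}}, is_potts G Z.
Proof.
pose r (A : {set 'I_k}) : rel 'I_n := [rel a b |
  [exists i in A, (a \in val (tnth G i)) && (b \in val (tnth G i))]].
pose c A := sval (cid (card_const_colorings (r A))).
have cP A := svalP (cid (card_const_colorings (r A))).
exists (\sum_(A : {set 'I_k}) ('X ^+ #|A|)%:P * 'X ^+ c A) => q v v0.
rewrite coloring_sumE // horner_sum (big_morph (fun p : {poly F} => p.[v])
  (fun x y => hornerD x y v) (horner0 v)).
have E (f : {ffun 'I_n -> 'I_q}) :
  (1 + v) ^+ count (fun e => ~~ bichromatic f e) G =
  \sum_(A : {set 'I_k}) v ^+ #|A| *
   [forall a, forall b, r A a b ==> (f a == f b)]%:R.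
  have -> : (1 + v) ^+ count (fun e => ~~ bichromatic f e) G =
     \prod_(i < k) (v * (~~ bichromatic f (tnth G i))%:R + 1).
    rewrite -[LHS](@iter_mulr_1 F) -big_const_seq big_mkcond /=.
    rewrite (big_tuple _ _ G xpredT).
    apply: eq_bigr => i _; case: bichromatic => /=.
      by rewrite mulr0 add0r.
    by rewrite mulr1 addrC.
  rewrite bigA_distr; apply: eq_bigr => A _; rewrite -big_mkcond /=.
  rewrite big_split /= prodr_const; congr (_ * _).
  case: (boolP [forall a, _]) => [H | /forallPn [a /forallPn [b]]].
    apply: big1 => i iA; case: (boolP (bichromatic _ _)) => //=.
    case/exists_inP => a ai /exists_inP [b bi] /eqP []; apply/eqP.
    move/forallP: H => /(_ a) /forallP /(_ b) /implyP; apply.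
    by apply/exists_inP; exists i => //; rewrite ai bi.
  rewrite negb_imply => /andP [/exists_inP [i iA /andP [ai bi]] fab].
  rewrite (bigD1 i) //=.
  have -> : bichromatic f (tnth G i).
    by apply/exists_inP; exists a => //; apply/exists_inP; exists b.
  by rewrite mul0r.
under [RHS]eq_bigr do rewrite E.
rewrite exchange_big /=; apply: eq_bigr => A _.
rewrite hornerM hornerC hornerXn hornerM hornerXn -polyC_exp hornerC.
rewrite -big_distrr /=; congr (_ * _).
rewrite -natrX -(cP A q) -sum1_card natr_sum [LHS]big_mkcond /=.
by apply: eq_bigr => f _; rewrite inE; case: [forall a, _].
Qed.

Lemma potts_unique (F : numFieldType) n k (G : graph n k)
    (Z1 Z2 : {poly {poly F}}) :
  is_potts G Z1 -> is_potts G Z2 -> Z1 = Z2.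
Proof.
have nat_roots (D : idomainType) (p : {poly D}) :
    (forall i j : nat, i%:R = j%:R :> D -> i = j) ->
    (forall i : nat, p.[i%:R] = 0) -> p = 0.
  move=> inj H; apply: (@roots_geq_poly_eq0 _ _ [seq i%:R | i <- iota 0 (size p)]).
  - by apply/allP => x /mapP [i _ ->]; apply/eqP; exact: H.
  - by rewrite map_inj_uniq ?iota_uniq // => i j /inj.
  - by rewrite size_map size_iota.
have injF (i j : nat) : i%:R = j%:R :> F -> i = j.
  by move/eqP; rewrite eqr_nat => /eqP.
move=> H1 H2; apply/eqP; rewrite -subr_eq0; apply/eqP; apply: (nat_roots).
  by move=> i j; rewrite -!polyC_natr => /polyC_inj; exact: injF.
move=> q; apply: (nat_roots) => // v.
have v0 : v%:R + 1 != 0 :> F by rewrite natr1 pnatr_eq0.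
by rewrite -polyC_natr !hornerE H1 // H2 // subrr.
Qed.

Definition potts (F : fieldType) n k (G : graph n k) : {poly {poly F}} :=
  sval (cid (potts_exists F G)).

Lemma pottsP (F : fieldType) n k (G : graph n k) : is_potts G (potts F G).
Proof. exact: svalP (cid (potts_exists F G)). Qed.

(* Coefficients range over an arbitrary commutative ring A: U_{n,k} itself is
   A = C, and its extension of scalars to C[q,v] is A = {poly {poly C}}. *)
Definition graph_space (A : comNzRingType) n k := {ffun graph n k -> A^o}.

Definition basis_graph (A : comNzRingType) n k (G : graph n k) :
    graph_space A n k :=
  [ffun H => (H == G)%:R].

Definition laplace_edge_basis (A : comNzRingType) n k (i : 'I_k)
    (G : graph n k) : graph_space A n k :=
  if [pick a | tnth G i == mk_edge a a] is Some a then
    - \sum_(m | m != a) basis_graph A (replace_edge G i (mk_edge a m))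
  else basis_graph A G.

Definition laplace_edge (A : comNzRingType) n k (i : 'I_k)
    (x : graph_space A n k) : graph_space A n k :=
  \sum_(G : graph n k) x G *: laplace_edge_basis A i G.

(* The composite B_1 o ... o B_k. *)
Definition laplace (A : comNzRingType) n k (x : graph_space A n k) :
    graph_space A n k :=
  foldr (@laplace_edge A n k) x (enum 'I_k).

Definition calZ (F : fieldType) n k : graph_space {poly {poly F}} n k :=
  \sum_(G : graph n k) potts F (del_loops G) *: basis_graph _ G.

Definition calZ_hat (F : fieldType) n k : graph_space {poly {poly F}} n k :=
  \sum_(G : graph n k | loopless G) potts F G *: basis_graph _ G.

Definition subst_opp_v (F : fieldType) (Z : {poly {poly F}}) :
    {poly {poly F}} :=
  map_poly (comp_poly (- 'X)) Z.

Definition space_opp_v (F : fieldType) n k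
    (x : graph_space {poly {poly F}} n k) : graph_space {poly {poly F}} n k :=
  [ffun G => subst_opp_v (x G)].

(* Main.v *)
(** At a natural number [q], the coefficient of [G] in [calZ] is a sum over
    colorings of a product over edges of local weights: 1 for a loop and
    [(1 + v) ^ [monochromatic]] for any other edge.  The operator [B_i] acts on
    the [i]-th factor only, replacing the weight of a proper edge [{a, b}] by
    [w {a, b} - w {a, a} - w {b, b}] and that of a loop by 0.  As
    [1 + v * d - 2 = - (1 + (- v) * d)] for [d] in {0, 1}, this turns the weights
    of [calZ] at [v] into the opposites of those of [calZ_hat] at [- v]. *)

Require Import Defs.
From mathcomp Require Import all_boot all_order all_algebra.
From mathcomp Require Import complex.
From mathcomp Require Import reals ring.

Import GRing.Theory Num.Theory.
Local Open Scope ring_scope.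
Local Open Scope complex_scope.

Set Implicit Arguments.
Unset Strict Implicit.
Unset Printing Implicit Defensive.

(** * Polynomial identities tested at natural numbers *)

Section NatRoots.

(** A nonzero difference would have more roots than its size allows. This serves for [q] with
    [D = {poly F}] and for [v] with [D = F]. *)
Lemma poly_nat_ext (D : idomainType) (p r : {poly D}) :
  injective (fun i : nat => i%:R : D) ->
  (forall i : nat, p.[i%:R] = r.[i%:R]) -> p = r.
Proof.
move=> inj H; apply/eqP; rewrite -subr_eq0; apply/eqP.
apply: (@roots_geq_poly_eq0 _ _ [seq i%:R | i <- iota 0 (size (p - r))]).
- by apply/allP => x /mapP [i _ ->]; rewrite /root !hornerE H subrr.
- by rewrite map_inj_uniq ?iota_uniq.
- by rewrite size_map size_iota.
Qed.

Lemma natr_inj (F : numFieldType) : injective (fun i : nat => i%:R : F).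
Proof. by move=> i j /eqP; rewrite eqr_nat => /eqP. Qed.

Lemma natr_poly_inj (F : numFieldType) :
  injective (fun i : nat => i%:R : {poly F}).
Proof. by move=> i j; rewrite -!polyC_natr => /polyC_inj /natr_inj. Qed.

End NatRoots.

(** * Loops and proper edges as unordered pairs *)

Section Edges.

Variable n : nat.
Implicit Types (a b : 'I_n) (e : edge n).

Lemma mk_edge_loopP a b : reflect (a = b) (is_loop (mk_edge a b)).
Proof.
apply: (iffP existsP) => [[c /eqP /(congr1 val) /= /setP E]|->]; last by exists b.
move: (E a) (E b); rewrite !inE !eqxx orbT !orbb /=.
by move=> /esym /eqP -> /esym /eqP ->.
Qed.

Lemma mk_edge_loop_inj a b : mk_edge a a = mk_edge b b -> a = b.
Proof.
by move=> /(congr1 val) /= /setP /(_ a); rewrite !inE !orbb eqxx => /esym /eqP.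
Qed.

Lemma edge_mk e : exists a b, e = mk_edge a b.
Proof.
case/existsP: (valP e) => a /existsP [b /eqP E].
by exists a, b; apply: val_inj.
Qed.

Lemma card_proper_edge e : ~~ is_loop e -> #|val e| = 2%N.
Proof.
have [a [b ->]] := edge_mk e => /mk_edge_loopP /eqP ab.
by rewrite /= cards2 ab.
Qed.

Lemma proper_edge_mk e a : ~~ is_loop e -> a \in val e ->
  exists2 b, b != a & e = mk_edge a b.
Proof.
have [u [v ->]] := edge_mk e => /mk_edge_loopP /eqP uv.
rewrite /= !inE => /orP [] /eqP ->; first by exists v; rewrite // eq_sym.
by exists u => //; apply: val_inj; rewrite /= setUC.
Qed.

(** Once an endpoint [a] of a proper edge is fixed, the other endpoint is unique. *)
Lemma sum_other_endpoint (A : nzSemiRingType) e a : ~~ is_loop e ->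
  \sum_(m | m != a) (e == mk_edge a m)%:R = (a \in val e)%:R :> A.
Proof.
move=> el; have [ae|ae] := boolP (a \in val e); last first.
  apply: big1 => m _; case: eqP => // E.
  by move: ae; rewrite E /= !inE eqxx.
have [b ba ->] := proper_edge_mk el ae.
rewrite (bigD1 b) //= eqxx big1 ?addr0 // => m /andP [ma mb].
case: eqP => // /(congr1 val) /= /setP /(_ m).
by rewrite !inE eqxx orbT (negPf ma) (negPf mb).
Qed.

End Edges.

(** * Coefficients of a single Laplace factor *)

Section LaplaceEdge.

Variables (n k : nat).
Implicit Types (G H : graph n k) (i : 'I_k).

Lemma tnth_replace_edge G i (e : edge n) j :
  tnth (replace_edge G i e) j = if j == i then e else tnth G j.
Proof. by rewrite tnth_mktuple. Qed.

Lemma replace_edge_id G i : replace_edge G i (tnth G i) = G.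
Proof.
by apply: eq_from_tnth => j; rewrite tnth_replace_edge; case: eqP => // ->.
Qed.

Lemma replace_edgeK G i (e f : edge n) :
  replace_edge (replace_edge G i e) i f = replace_edge G i f.
Proof.
by apply: eq_from_tnth => j; rewrite !tnth_replace_edge; case: eqP.
Qed.

(** The graphs [G] whose image under [B_i] involves [H] are [H] itself, when its [i]-th edge is
    proper, and the graphs obtained by contracting that edge to a loop at one of its endpoints. *)
Lemma laplace_edgeE (A : comNzRingType) i (x : graph_space A n k) H :
  laplace_edge i x H =
  if is_loop (tnth H i) then 0 else
  x H - \sum_(a in val (tnth H i)) x (replace_edge H i (mk_edge a a)).
Proof.
rewrite /laplace_edge sum_ffunE.
have basisE G : laplace_edge_basis A i G H =
    (~~ is_loop (tnth G i) && (G == H))%:R -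
    \sum_a \sum_(m | m != a)
      ((G == replace_edge H i (mk_edge a a)) && (tnth H i == mk_edge a m))%:R.
  (* Inverts the replacement: [G] is expressed through [H], so that for fixed [a] only one [G]
     survives in the sum below. *)
  have repE a m : (H == replace_edge G i (mk_edge a m)) &&
      (tnth G i == mk_edge a a) =
      (G == replace_edge H i (mk_edge a a)) && (tnth H i == mk_edge a m).
    apply/andP/andP => -[/eqP -> /eqP E];
      by rewrite tnth_replace_edge eqxx replace_edgeK -E replace_edge_id.
  under eq_bigr do under eq_bigr do rewrite -repE.
  rewrite /laplace_edge_basis; case: pickP => [a /eqP Ga|Gl].
    have -> : is_loop (tnth G i) by rewrite Ga; apply/mk_edge_loopP.
    rewrite sub0r !ffunE sum_ffunE [in RHS](bigD1 a) //= [X in _ + X]big1 ?addr0.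
      by congr (- _); apply: eq_bigr => m _; rewrite ffunE Ga eqxx andbT.
    move=> b ba; apply: big1 => m _; rewrite Ga.
    rewrite [mk_edge a a == _](_ : _ = false) ?andbF //.
    by apply: contraNF ba => /eqP /mk_edge_loop_inj ->.
  rewrite ffunE eq_sym big1 ?subr0.
    by have -> : is_loop (tnth G i) = false by apply/existsP => -[a]; rewrite Gl.
  by move=> a _; apply: big1 => m _; rewrite Gl andbF.
have -> : \sum_G (x G *: laplace_edge_basis A i G) H =
    (~~ is_loop (tnth H i))%:R * x H -
    \sum_a x (replace_edge H i (mk_edge a a)) *
      \sum_(m | m != a) (tnth H i == mk_edge a m)%:R.
  (* Scaling in the regular module [A^o] is multiplication in [A]. *)
  transitivity (\sum_G (x G : A) * (laplace_edge_basis A i G H : A)).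
    by apply: eq_bigr => G _; rewrite ffunE.
  under eq_bigr do rewrite basisE mulrBr.
  rewrite sumrB; congr (_ - _).
    rewrite (bigD1 H) //= eqxx andbT big1 ?addr0 1?mulrC // => G /negPf ->.
    by rewrite andbF mulr0.
  under eq_bigr do rewrite mulr_sumr.
  rewrite exchange_big; apply: eq_bigr => a _ /=.
  rewrite (bigD1 (replace_edge H i (mk_edge a a))) //= eqxx [X in _ + X]big1 ?addr0 //.
  by move=> G /negPf ->; rewrite big1 ?mulr0.
case: ifPn => [Hl|Hl] /=.
  rewrite mul0r sub0r big1 ?oppr0 // => a _; rewrite big1 ?mulr0 // => m ma.
  case: eqP => // E; move: Hl ma.
  by rewrite E => /mk_edge_loopP ->; rewrite eqxx.
rewrite mul1r [in RHS]big_mkcond; congr (_ - _); apply: eq_bigr => a _.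
by rewrite sum_other_endpoint //; case: ifP; rewrite ?mulr1 ?mulr0.
Qed.

End LaplaceEdge.

(** * The Laplace operator on sums of product weights *)

Section LocalWeights.

Definition laplace_weight (A : comNzRingType) n (w : edge n -> A) (e : edge n)
    : A :=
  if is_loop e then 0 else w e - \sum_(a in val e) w (mk_edge a a).

(** The map [phi] will be evaluation at a natural number [q], since only then are the coefficients
    sums over colorings. Additivity suffices because each [B_i] has integer matrix entries. *)
Lemma laplace_prod_weights (A B : comNzRingType) (phi : {additive A -> B})
    n k (I : finType) (w : I -> edge n -> B) (x : graph_space A n k) :
  (forall G, phi (x G) = \sum_f \prod_i w f (tnth G i)) ->
  forall G, phi (laplace x G) =
    \sum_f \prod_i laplace_weight (w f) (tnth G i).
Proof.
move=> xE.
(* Weights after applying only the factors [B_i] with [i] in [s]; the induction is on [s]. *)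
pose W (s : seq _) f (i : 'I_k) e := if i \in s then laplace_weight (w f) e else w f e.
suff H (s : seq _) : uniq s -> forall G, phi (foldr (@laplace_edge A n k) x s G) =
    \sum_f \prod_i W s f i (tnth G i).
  move=> G; rewrite H ?enum_uniq //; apply: eq_bigr => f _.
  by apply: eq_bigr => i _; rewrite /W mem_enum.
elim: s => [_ G|i s IH /= /andP [is_ /IH {}IH] G]; first by rewrite /= xE.
(* As [i] is not in [s], its factor is still [w f]; [G] and its modifications at [i] share all other
   factors. *)
have WE f H : (forall j, j != i -> tnth H j = tnth G j) ->
    \prod_j W s f j (tnth H j) =
    w f (tnth H i) * \prod_(j | j != i) W s f j (tnth G j).
  move=> HG; rewrite (bigD1 i) //= {1}/W (negPf is_); congr (_ * _).
  by apply: eq_bigr => j ji; rewrite HG.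
have -> : \sum_f \prod_j W (i :: s) f j (tnth G j) =
    \sum_f laplace_weight (w f) (tnth G i) *
           \prod_(j | j != i) W s f j (tnth G j).
  apply: eq_bigr => f _; rewrite (bigD1 i) //= {1}/W mem_head; congr (_ * _).
  by apply: eq_bigr => j ji; rewrite /W in_cons (negPf ji).
rewrite laplace_edgeE /laplace_weight; case: ifP => _.
  by rewrite raddf0 big1 // => f _; rewrite mul0r.
rewrite raddfB raddf_sum /= IH.
under [X in _ - X]eq_bigr do rewrite IH.
rewrite exchange_big -sumrB; apply: eq_bigr => f _.
rewrite mulrBl WE // mulr_suml; congr (_ - _); apply: eq_bigr => a _.
rewrite WE => [|j ji]; first by rewrite tnth_replace_edge eqxx.
by rewrite tnth_replace_edge (negPf ji).
Qed.

End LocalWeights.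

(** * Potts weights and the final identity *)

Section Potts.

Variable F : numFieldType.

Definition mono n q (f : {ffun 'I_n -> 'I_q}) (e : edge n) : bool :=
  ~~ bichromatic f e.

Lemma potts_horner n k (G : graph n k) (q : nat) :
  (potts F G).[q%:R] =
  \sum_(f : {ffun 'I_n -> 'I_q}) \prod_(e <- G) (1 + 'X) ^+ mono f e.
Proof.
apply: poly_nat_ext; first exact: natr_inj.
move=> v; have v0 : v%:R + 1 != 0 :> F by rewrite natr1 pnatr_eq0.
rewrite -polyC_natr pottsP // coloring_sumE // horner_sum.
(* The power with exponent [count] is unfolded into a product over the monochromatic edges. *)
apply: eq_bigr => f _; rewrite horner_prod -[LHS](@iter_mulr_1 F).
rewrite -big_const_seq big_mkcond; apply: eq_bigr => e _.
by rewrite /mono; case: bichromatic; rewrite /= !hornerE.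
Qed.

Definition potts_weight n q (f : {ffun 'I_n -> 'I_q}) (e : edge n) : {poly F} :=
  if is_loop e then 1 else (1 + 'X) ^+ mono f e.

Lemma potts_del_loops_horner n k (G : graph n k) (q : nat) :
  (potts F (del_loops G)).[q%:R] =
  \sum_(f : {ffun 'I_n -> 'I_q}) \prod_i potts_weight f (tnth G i).
Proof.
rewrite potts_horner; apply: eq_bigr => f _.
rewrite -(big_tuple _ _ G xpredT) big_filter big_mkcond /=.
by apply: eq_bigr => e _; rewrite /potts_weight; case: is_loop.
Qed.

Lemma laplace_potts_weight n q (f : {ffun 'I_n -> 'I_q}) (e : edge n) :
  laplace_weight (potts_weight f) e =
  if is_loop e then 0 else - (1 - 'X) ^+ mono f e.
Proof.
rewrite /laplace_weight /potts_weight; case: ifPn => //= el.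
rewrite (eq_bigr (fun=> 1)) => [|a _]; last by rewrite (introT (mk_edge_loopP a a)).
rewrite (negPf el) sumr_const card_proper_edge //; by case: (mono f e) => /=; ring.
Qed.

Lemma calZE n k (G : graph n k) : calZ F n k G = potts F (del_loops G).
Proof.
rewrite /calZ sum_ffunE (bigD1 G) //= big1 => [|H HG].
  by rewrite !ffunE eqxx addr0; apply: mulr1.
by rewrite !ffunE eq_sym (negPf HG); apply: mulr0.
Qed.

Lemma calZ_hatE n k (G : graph n k) :
  calZ_hat F n k G = if loopless G then potts F G else 0.
Proof.
rewrite /calZ_hat sum_ffunE big_mkcond (bigD1 G) //= big1 => [|H HG].
  by rewrite addr0; case: ifP => // _; rewrite !ffunE eqxx; apply: mulr1.
by case: ifP => // _; rewrite !ffunE eq_sym (negPf HG); apply: mulr0.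
Qed.

Lemma horner_subst_opp_v (Z : {poly {poly F}}) (q : nat) :
  (subst_opp_v Z).[q%:R] = Z.[q%:R] \Po (- 'X).
Proof.
(* The constant [q] is fixed by the substitution of [-v] for [v]. *)
by rewrite /subst_opp_v -[in LHS](rmorph_nat (comp_poly (- 'X))) horner_map.
Qed.

Lemma potts_opp_horner n k (G : graph n k) (q : nat) :
  (potts F G).[q%:R] \Po (- 'X) =
  \sum_(f : {ffun 'I_n -> 'I_q}) \prod_i (1 - 'X) ^+ mono f (tnth G i).
Proof.
rewrite potts_horner rmorph_sum; apply: eq_bigr => f _ /=.
rewrite rmorph_prod (big_tuple _ _ G xpredT) /=; apply: eq_bigr => i _.
by rewrite rmorphXn rmorphD rmorph1 /= comp_polyX.
Qed.

Lemma laplace_calZ n k :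
  laplace (calZ F n k) = (-1) ^+ k *: space_opp_v (calZ_hat F n k).
Proof.
apply/ffunP => G; rewrite [RHS]ffunE [X in _ *: X]ffunE.
apply: poly_nat_ext; first exact: natr_poly_inj.
(* Exposes evaluation at [q] as the additive map [phi]. *)
move=> q; rewrite -[LHS]/(horner_eval q%:R (laplace (calZ F n k) G)).
rewrite (laplace_prod_weights (w := @potts_weight n q)) => [|H]; last first.
  by rewrite calZE; apply: potts_del_loops_horner.
rewrite [_ *: _]/(_ * _) hornerM horner_subst_opp_v.
have -> : ((-1) ^+ k : {poly {poly F}}).[q%:R] = (-1) ^+ k.
  by rewrite horner_exp hornerN hornerC.
rewrite calZ_hatE; have [Gl|] := boolP (loopless G); last first.
  (* A loop has transformed weight 0, which kills the product for every coloring. *)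
  case/allPn => _ /tnthP [i ->] /negPn Gi; rewrite horner0 comp_poly0 mulr0.
  by apply: big1 => f _; rewrite (bigD1 i) //= laplace_potts_weight Gi mul0r.
rewrite potts_opp_horner mulr_sumr; apply: eq_bigr => f _.
(* The sign is distributed as one factor -1 per edge. *)
rewrite -[X in (-1) ^+ X](card_ord k) -prodrN; apply: eq_bigr => i _.
by rewrite laplace_potts_weight (negPf (allP Gl _ (mem_tnth i G))).
Qed.

End Potts.

Theorem theorem1p2 (R : realType) (n k : nat) (hn : (1 <= n)%N) :
  laplace (calZ R[i] n k) = (-1) ^+ k *: space_opp_v (calZ_hat R[i] n k).
Proof. exact: laplace_calZ. Qed.
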